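(* Let $P$ be a probability measure on $\mathbb{R}^p$ and let $X_1,X_2,\dots$ be independent and identically distributed random vectors with law $P$. Then $$\sup_{x\in\mathbb{R}^p,\ \tau\in[0,\infty]}|LLD_n(x,\tau)-LLD(x,\tau)|\xrightarrow[n\to\infty]{}0\quad\text{almost surely.}$$
   Context: $p\ge 1$; $\|\cdot\|$ is the Euclidean norm on $\mathbb{R}^p$. For $x\in\mathbb{R}^p$ and $\tau\in[0,\infty]$, $$Z_\tau(x)=\{(x_1,x_2)\in\mathbb{R}^p\times\mathbb{R}^p:\ \max_{i=1,2}\|x-x_i\|\le\|x_1-x_2\|\le\tau\}$$ (for $\tau=\infty$ the last inequality is vacuous). The local lens depth of $x$ with respect to $P$ is $LLD(x,\tau)=\int_{\mathbb{R}^p\times\mathbb{R}^p}\mathbf{I}((x_1,x_2)\in Z_\tau(x))\,dP(x_1)\,dP(x_2)$, and its sample version, for $n\ge 2$, is $$LLD_n(x,\tau)=\frac{1}{\binom n2}\sum_{1\le i<j\le n}\mathbf{I}((X_i,X_j)\in Z_\tau(x)).$$ *)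

(* Defs.v *)
From HB Require Import structures.
From mathcomp Require Import all_boot all_order all_algebra finmap.
From mathcomp Require Import all_classical all_reals all_analysis.

Set Implicit Arguments.
Unset Strict Implicit.
Unset Printing Implicit Defensive.

Import Order.TTheory GRing.Theory Num.Theory.
Import numFieldNormedType.Exports.

Local Open Scope classical_set_scope.
Local Open Scope ring_scope.

(* The norm that MathComp-Analysis puts on ['rV[R]_p] is the sup norm, hence
   this separate Euclidean norm.  Both induce the same topology. *)
Definition enorm (R : realType) (p : nat) (v : 'rV[R]_p) : R :=
  Num.sqrt (\sum_(j < p) v ord0 j ^+ 2).

(* R^p with its Borel sigma-algebra; convertible to ['rV[R]_p]. *)
Definition borel_rV (R : realType) (p : nat) :=
  g_sigma_algebraType (@open 'rV[R]_p).

Definition lens (R : realType) (p : nat) (tau : \bar R) (x : 'rV[R]_p) :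
    set ('rV[R]_p * 'rV[R]_p) :=
  [set z | Num.max (enorm (x - z.1)) (enorm (x - z.2)) <= enorm (z.1 - z.2)
           /\ ((enorm (z.1 - z.2))%:E <= tau)%E].

Definition LLD (R : realType) (p : nat) (P : probability (borel_rV R p) R)
    (x : 'rV[R]_p) (tau : \bar R) : R :=
  \int[(P \x P)%E]_z \1_(lens tau x) z.

(* [X] is indexed from 0, so the sample of size [n] is [X 0, ..., X n.-1].
   For [n < 2] the value is 0, as ['C(n, 2) = 0]. *)
Definition LLDn (R : realType) (p : nat) (X : nat -> 'rV[R]_p) (n : nat)
    (x : 'rV[R]_p) (tau : \bar R) : R :=
  ('C(n, 2))%:R^-1 *
  \sum_(i < n) \sum_(j < n | (i < j)%N) \1_(lens tau x) (X i, X j).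

Definition mutually_independent (d d' : measure_display)
    (Omega : measurableType d) (T : measurableType d') (R : realType)
    (Q : probability Omega R) (X : nat -> {RV Q >-> T}) : Prop :=
  forall (J : {fset nat}) (A : nat -> set T),
    (forall i, i \in J -> measurable (A i)) ->
    Q (\bigcap_(i in [set` J]) (X i @^-1` A i)) =
    (\prod_(i <- J) Q (X i @^-1` A i))%E.

(* Equality of laws is required on measurable sets only: outside them the
   values of a measure in the library are meaningless. *)
Definition has_law (d d' : measure_display)
    (Omega : measurableType d) (T : measurableType d') (R : realType)
    (Q : probability Omega R) (X : {RV Q >-> T}) (P : probability T R) : Prop :=
  forall A : set T, measurable A -> distribution Q X A = P A.

(* Main.v *)
Require Import Defs.
From Stdlib Require Import Lia.
From mathcomp Require Import all_boot all_order all_algebra finmap.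
From mathcomp Require Import all_classical all_reals all_analysis.
From mathcomp Require Import measurable_realfun ring lra zify.

Set Implicit Arguments.
Unset Strict Implicit.
Unset Printing Implicit Defensive.

Import Order.TTheory GRing.Theory Num.Theory.
Import numFieldNormedType.Exports.

Local Open Scope classical_set_scope.
Local Open Scope ring_scope.

(** Why the theorem holds.

    For a fixed first argument [u], the section [{v | (u, v) in lens tau x}] is
    cut out of R^p by three inequalities of the form
    [a + b |v|^2 + <c, v> <= 0]: it is an intersection of three half-spaces in
    the feature space of the functions [1, |v|^2, v_0, ..., v_(p-1)]
    ([xsection_lens]). Let [P_n] be the empirical measure of the sample. If
    [P_n] is [e]-close to [P] uniformly over such intersections, then
    integrating sections first against [P_n] and then, using the symmetry of
    the lens in its two arguments, against [P], shows that the masses of the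
    lens under [P_n x P_n] and [P x P] differ by at most [2 e], uniformly in
    [x] and [tau] ([empirical_product_near]). Passing from [P_n x P_n] to
    pairs [i < j] costs at most [1 / (n - 1)] ([pairs_near_square]). So the
    U-statistic reduces to a Glivenko-Cantelli theorem for one sample.

    That theorem is obtained by bracketing: for every [e > 0] there are
    finitely many pairs of measurable sets [L, U] with [P (U \ L) <= e] such
    that each set of the class lies between [L] and [U] for one of the pairs.
    The strong law applied to the countably many sets [L] and [U] then forces
    uniform convergence ([glivenko_cantelli]).

    No regularity of [P] is available, so that half-spaces are bracketed by
    induction on the number of features ([finitely_bracketed_halfspace]).
    Near a direction [w0], only points close to the hyperplane
    [{w0 . phi = 0}] are ambiguous. The points off the hyperplane but close to
    it have small mass, by continuity of the measure. On the hyperplane itself,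
    which may carry positive mass, one feature is a combination of the others,
    and the induction hypothesis applies. Compactness of the unit sphere makes
    the number of directions finite.

    The strong law for indicators ([slln_events]) comes from second moments
    along the squares [n = k ^ 2], and from the small variation of averages
    between consecutive squares. *)

(** * Measurable sets defined by inequalities *)

Lemma measurable_le {d} {T : measurableType d} {R : realType} (f g : T -> R) :
  measurable_fun setT f -> measurable_fun setT g ->
  measurable [set t | f t <= g t].
Proof.
by move=> mf mg; rewrite -[X in measurable X]setTI; exact: measurable_fun_le.
Qed.

Lemma measurable_lt {d} {T : measurableType d} {R : realType} (f g : T -> R) :
  measurable_fun setT f -> measurable_fun setT g ->
  measurable [set t | f t < g t].
Proof.
move=> mf mg; have -> : [set t | f t < g t] = ~` [set t | g t <= f t].
  by apply/seteqP; split=> t /=; rewrite ltNge => /negP.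
exact/measurableC/measurable_le.
Qed.

(** * Finite bracketings *)

(** Finiteness of the L^1 bracketing number of [C] at scale [e]. *)
Definition finitely_bracketed {d} {T : measurableType d} {R : realType}
    (P : probability T R) (e : R) (C : set (set T)) :=
  exists2 F : set (set T * set T), finite_set F &
    (forall b, F b ->
      [/\ measurable b.1, measurable b.2 & (P (b.2 `\` b.1) <= e%:E)%E]) /\
    (forall A, C A -> exists2 b, F b & b.1 `<=` A /\ A `<=` b.2).

(** Half-spaces through the origin of feature space. Affine half-spaces are
    obtained by including a constant function among the features. *)
Definition halfspace {T : Type} {R : realType} {D : nat}
    (phi : 'I_D -> T -> R) (w : 'rV[R]_D) : set T :=
  [set t | \sum_(i < D) w ord0 i * phi i t <= 0].

Section Brackets.
Context {d : measure_display} {T : measurableType d} {R : realType}.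
Variable P : probability T R.
Implicit Types (C : set (set T)) (e : R).

Lemma finitely_bracketed_sub e C C' :
  C `<=` C' -> finitely_bracketed P e C' -> finitely_bracketed P e C.
Proof.
move=> CC' [F Ffin [Fm FC]]; exists F => //; split=> // A /CC'; exact: FC.
Qed.

Lemma finitely_bracketed1 e A : 0 <= e -> measurable A ->
  finitely_bracketed P e [set A].
Proof.
move=> e0 mA; exists [set (A, A)]; first exact: finite_set1.
split=> [_ ->|_ ->]; last by exists (A, A) => //; split=> t.
by split => //=; rewrite setDv measure0 lee_fin.
Qed.

Lemma finitely_bracketed_bigcup (I : choiceType) (J : set I)
    (C : I -> set (set T)) e : finite_set J ->
  (forall i, J i -> finitely_bracketed P e (C i)) ->
  finitely_bracketed P e (\bigcup_(i in J) C i).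
Proof.
move=> Jfin CJ.
have /choice[F FP] : forall i, exists F, J i -> finite_set F /\
    ((forall b, F b ->
      [/\ measurable b.1, measurable b.2 & (P (b.2 `\` b.1) <= e%:E)%E]) /\
    (forall A, C i A -> exists2 b, F b & b.1 `<=` A /\ A `<=` b.2)).
  move=> i; have [Ji|] := pselect (J i); last by exists set0.
  by have [F ? ?] := CJ i Ji; exists F.
exists (\bigcup_(i in J) F i).
  by apply: bigcup_finite => // i /FP[].
split=> [b [i Ji Fb]|A [i Ji CA]]; first by have [_ [+ _]] := FP i Ji; exact.
have [_ [_ /(_ _ CA)[b Fb Ab]]] := FP i Ji.
by exists b => //; exists i.
Qed.

(** Intersecting brackets gives a bracket whose gap is covered by the two
    gaps. *)
Lemma finitely_bracketedI e1 e2 C1 C2 :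
  finitely_bracketed P e1 C1 -> finitely_bracketed P e2 C2 ->
  finitely_bracketed P (e1 + e2) [set A `&` B | A in C1 & B in C2].
Proof.
move=> [F1 F1fin [F1m FC1]] [F2 F2fin [F2m FC2]].
pose meet (b : (set T * set T) * (set T * set T)) :=
  (b.1.1 `&` b.2.1, b.1.2 `&` b.2.2).
exists (meet @` (F1 `*` F2)); first by apply/finite_image/finite_setX.
split=> [_ [[b c] [/= /F1m[b1 b2 bP] /F2m[c1 c2 cP]] <-]|].
  split=> /=; [exact: measurableI..|].
  rewrite EFinD; apply: le_trans (leeD bP cP).
  have mb : measurable (b.2 `\` b.1) by exact: measurableD.
  have mc : measurable (c.2 `\` c.1) by exact: measurableD.
  apply: le_trans (measureU2 _ mb mc).
  apply: le_measure; rewrite ?inE.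
  - by apply: measurableD; exact: measurableI.
  - exact: measurableU.
  - move=> t [[tb tc] /not_andP[?|?]]; by [left|right].
move=> _ [A /FC1[b Fb [bA Ab]] [B /FC2[c Fc [cB Bc]] <-]].
exists (meet (b, c)); first by exists (b, c).
by split=> /= t [? ?]; split; auto.
Qed.


(** A bracket for the trace on the hyperplane [{w0 . phi = 0}] extends to a
    bracket for the whole half-space. Write [f = w0 . phi] and
    [g = sum_i |phi i|]. A direction within [r] of [w0] changes [f] by at most
    [r g], so that off the hyperplane the sign can change only on
    [N = {0 < |f| <= r g}]. These sets decrease to the empty set with [r], and
    [r] is chosen to make [P N] small. *)
Lemma finitely_bracketed_near_direction (D : nat) (phi : 'I_D -> T -> R)
    (mphi : forall i, measurable_fun setT (phi i)) (w0 : 'rV[R]_D) E e :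
  measurable E -> 0 < e ->
  (forall e', 0 < e' -> finitely_bracketed P e'
    [set E `&` [set t | \sum_(i < D) w0 ord0 i * phi i t = 0]
           `&` halfspace phi w | w in setT]) ->
  exists2 r : R, 0 < r & finitely_bracketed P e
    [set E `&` halfspace phi w |
       w in [set w : 'rV[R]_D | forall i, `|w ord0 i - w0 ord0 i| <= r]].
Proof.
move=> mE e0 IH.
pose f t := \sum_(i < D) w0 ord0 i * phi i t.
pose g t := \sum_(i < D) `|phi i t|.
have mf : measurable_fun setT f.
  by apply: measurable_sum => i; exact: measurable_funM.
have mg : measurable_fun setT g.
  by apply: measurable_sum => i; exact: measurableT_comp.
pose N (k : nat) :=
  [set t | 0 < `|f t|] `&` [set t | `|f t| <= k.+1%:R^-1 * g t].
have mN k : measurable (N k).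
  apply: measurableI.
    by apply: measurable_lt => //; exact: measurableT_comp.
  apply: measurable_le; first exact: measurableT_comp.
  exact: measurable_funM.
have N0 : \bigcap_k N k = set0.
  rewrite -subset0 => t Nt; have [ft _] := Nt 0%N I.
  have g0 : 0 <= g t by apply: sumr_ge0.
  (* Adding 1 to [g t] keeps the bound [|f t| / (g t + 1)] well defined. *)
  have ft_g := divr_gt0 ft (ltr_pwDr ltr01 g0).
  have [k _ /(_ k (leqnn k))] := near_infty_natSinv_lt (PosNum ft_g).
  rewrite /= ltr_pdivlMr ?ltr_wpDl// mulrDr mulr1 => kft.
  have [_ /=] := Nt k I; rewrite leNgt => /negP; apply.
  by apply: le_lt_trans kft; rewrite lerDl.
have [k PNk] : exists k, (P (N k) <= (e / 2)%:E)%E.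
  have h : (P \o N) k @[k --> \oo] --> 0%E.
    rewrite -(measure0 P) -N0; apply: nonincreasing_cvg_mu; rewrite ?N0//.
      by rewrite (le_lt_trans (probability_le1 _ _))// ltry.
    move=> m n mn; apply/subsetPset => t [ft /= le]; split=> //=.
    apply: le_trans le _; apply: ler_wpM2r; first exact: sumr_ge0.
    by rewrite lef_pV2 ?posrE// ler_nat ltnS.
  have /fine_cvgP[_ /cvgrPdist_le /(_ (e / 2))] := h.
  rewrite divr_gt0// => /(_ isT)[k _ /(_ k (leqnn k))] /=.
  rewrite sub0r normrN ger0_norm ?fine_ge0// => ek; exists k.
  by rewrite -[leLHS]fineK ?lee_fin// fin_num_measure.
exists k.+1%:R^-1; first by rewrite invr_gt0.
have [F Ffin [Fm FC]] := IH (e / 2) (divr_gt0 e0 (ltr0Sn _ _)).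
pose E0 := E `&` [set t | f t = 0].
pose Em := E `&` [set t | f t < 0].
have mE0 : measurable E0.
  apply: measurableI => //; rewrite -[X in measurable X]setTI.
  exact: (mf measurableT [set 0] (measurable_set1 _)).
have mEm : measurable Em.
  by apply: measurableI => //; exact: measurable_lt.
(* Outside [E0] and [N k] the half-space of any nearby direction agrees with
   [{f < 0}]; [N k] is put into the upper set only. *)
pose ext (b : set T * set T) :=
  ((b.1 `&` E0) `|` (Em `\` N k), (b.2 `&` E0) `|` (Em `|` N k)).
exists (ext @` F); first exact: finite_image.
split=> [_ [b /Fm[b1 b2 bP] <-]|_ [w /= wP <-]].
  split=> /=.
  - by apply: measurableU; [exact: measurableI|exact: measurableD].
  - by apply: measurableU; [exact: measurableI|exact: measurableU].
  rewrite (splitr e) EFinD; apply: le_trans (leeD bP PNk).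
  have mb : measurable (b.2 `\` b.1) by exact: measurableD.
  apply: le_trans (measureU2 _ mb (mN k)).
  apply: le_measure; rewrite ?inE.
  - apply: measurableD; apply: measurableU.
    + exact: measurableI.
    + exact: measurableU.
    + exact: measurableI.
    + exact: measurableD.
  - exact: measurableU.
  - move=> t [+ /not_orP[]]; case=> [[tb tE0]|tN]
      /not_andP[]// tb' /not_andP[] tN'; auto.
    + by left.
    + by left.
    + case: tN => //; by right.
    + by right; apply: contrapT.
    + case: tN => //; by right.
    + by right; apply: contrapT.
have [b Fb [bA Ab]] := FC _ (ex_intro2 _ _ w I erefl).
have close t : ~ N k t -> f t != 0 -> `|\sum_i w ord0 i * phi i t - f t| < `|f t|.
  move=> Nt ft.
  have {}Nt : k.+1%:R^-1 * g t < `|f t|.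
    by rewrite ltNge; apply/negP => le; apply: Nt; split => //=; rewrite normr_gt0.
  apply: le_lt_trans Nt; rewrite /f -sumrB /g mulr_sumr.
  apply: le_trans (ler_norm_sum _ _ _) _; apply: ler_sum => i _.
  by rewrite -mulrBl normrM ler_wpM2r.
exists (ext b); first by exists b.
split=> t /=.
  case=> [[/bA[[Et ft] wt]]//|[[Et ft] Nt]]; split => //.
  rewrite /halfspace /=; have := close t Nt (ltr0_neq0 ft).
  by rewrite (ltr0_norm ft) ltr_norml => /andP[_]; lra.
move=> [Et wt].
have [ft|ft] := eqVneq (f t) 0; first by left; split; [exact: Ab|].
right; have [Nt|Nt] := pselect (N k t); [by right|left; split=> //=].
have := close t Nt ft; move: wt; rewrite /halfspace/=.
have [//|ft0] := ltP (f t) 0.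
by rewrite (ger0_norm ft0) ltr_norml => ? /andP[]; lra.
Qed.

Lemma finitely_bracketedU e C1 C2 :
  finitely_bracketed P e C1 -> finitely_bracketed P e C2 ->
  finitely_bracketed P e (C1 `|` C2).
Proof.
move=> h1 h2.
have h : finitely_bracketed P e (\bigcup_(b in setT) if b then C1 else C2).
  by apply: finitely_bracketed_bigcup => [|[] _//]; exact: finite_finset.
by apply: finitely_bracketed_sub h => A [?|?]; [exists true|exists false].
Qed.

(** On the hyperplane of [w0], the feature [j] is a combination of the other
    ones, and can be eliminated. *)
Lemma halfspace_drop (D : nat) (phi : 'I_D.+1 -> T -> R) (w0 w : 'rV[R]_D.+1)
    (j : 'I_D.+1) t :
  w0 ord0 j != 0 -> \sum_(i < D.+1) w0 ord0 i * phi i t = 0 ->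
  \sum_(i < D.+1) w ord0 i * phi i t =
  \sum_(i < D) (\row_i (w ord0 (lift j i) -
      w ord0 j / w0 ord0 j * w0 ord0 (lift j i))) ord0 i * phi (lift j i) t.
Proof.
move=> w0j; rewrite (bigD1_ord j)//= [X in _ -> X = _](bigD1_ord j)//=.
move=> /eqP; rewrite addr_eq0 => /eqP eqj.
have -> : phi j t = - (w0 ord0 j)^-1 *
    \sum_(i < D) w0 ord0 (lift j i) * phi (lift j i) t.
  by rewrite mulNr -mulrN -eqj mulKf.
rewrite !mulr_sumr -big_split/=; apply: eq_bigr => i _; rewrite mxE.
by field.
Qed.

(** Every nonzero direction can therefore be moved to the unit sphere, which is
    compact. *)
Lemma halfspaceZ (D : nat) (phi : 'I_D -> T -> R) (c : R) (w : 'rV[R]_D) :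
  0 < c -> halfspace phi (c *: w) = halfspace phi w.
Proof.
move=> c0; rewrite /halfspace.
under eq_set do under eq_bigr do rewrite mxE -mulrA.
by under eq_set do rewrite -mulr_sumr pmulr_rle0//.
Qed.

(** The set [E] is there for the induction: a hyperplane of the current
    feature space becomes the ambient set for one feature less. *)
Lemma finitely_bracketed_halfspace (D : nat) (phi : 'I_D -> T -> R)
    (mphi : forall i, measurable_fun setT (phi i)) E e :
  measurable E -> 0 < e ->
  finitely_bracketed P e [set E `&` halfspace phi w | w in setT].
Proof.
elim: D => [|D IH] in phi mphi E e *.
  move=> mE /ltW e0; apply: finitely_bracketed_sub (finitely_bracketed1 _ mE) => //.
  move=> _ [w _ <-] /=; apply/seteqP; split=> [t []//|t Et].
  by split=> //; rewrite /halfspace/= big_ord0.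
move=> mE e0.
pose S := [set w : 'rV[R]_D.+1 | `|w| = 1].
have near w0 : exists r : R, S w0 -> 0 < r /\ finitely_bracketed P e
    [set E `&` halfspace phi w |
       w in [set w : 'rV[R]_D.+1 | forall i, `|w ord0 i - w0 ord0 i| <= r]].
  have [Sw0|] := pselect (S w0); last by exists 0.
  have [j w0j] : exists j, w0 ord0 j != 0.
    apply: contrapT => /forallNP w00; suff w0E : w0 = 0.
      by move: Sw0; rewrite /S/= w0E normr0 => /esym/eqP; rewrite oner_eq0.
    by apply/rowP => j; rewrite mxE; have /negP/negPn/eqP := w00 j.
  have [|r r0 Cr] :=
    @finitely_bracketed_near_direction D.+1 phi mphi w0 E e mE e0; last by exists r.
  move=> e' e'0.
  set E0 := E `&` _.
  have mE0 : measurable E0.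
    apply: measurableI => //; rewrite -[X in measurable X]setTI.
    have mf : measurable_fun setT
        (fun t => \sum_(i < D.+1) w0 ord0 i * phi i t).
      by apply: measurable_sum => i; exact: measurable_funM.
    exact: (mf measurableT [set 0] (measurable_set1 _)).
  apply: finitely_bracketed_sub
    (IH (fun i => phi (lift j i)) (fun i => mphi _) E0 e' mE0 e'0).
  move=> _ [w _ <-]; eexists; first exact: I.
  by apply/seteqP; split=> t [E0t wt]; split=> //; move: wt;
    rewrite /halfspace/= (halfspace_drop w w0j E0t.2); exact.
have /choice[r rP] := near.
have cS : compact S.
  apply: bounded_closed_compact.
    exists 1; split=> // M M1 w Sw; by rewrite /S/= in Sw *; rewrite Sw ltW.
  apply: (@preimage_closed 'rV[R]_D.+1 R Num.norm [set 1]).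
    by move=> w _; exact: norm_continuous.
  exact: (accessible_closed_set1 (hausdorff_accessible (@Rhausdorff R))).
move: cS; rewrite compact_cover => /(_ _ S (fun w => ball w (r w))).
case=> [w _|w Sw|J JS SJ].
- exact: ball_open.
- by exists w => //; apply: ballxx; have [] := rP w Sw.
have /(finitely_bracketedU (finitely_bracketed1 (ltW e0) mE)) :
    finitely_bracketed P e (\bigcup_(v in [set` J]) [set E `&` halfspace phi w |
       w in [set w : 'rV[R]_D.+1 | forall i, `|w ord0 i - v ord0 i| <= r v]]).
  apply: finitely_bracketed_bigcup => [|v Jv]; first exact: finite_fset.
  by have /set_mem/rP[] := JS _ Jv.
apply: finitely_bracketed_sub.
(* The zero direction is off the sphere; its half-space is everything. *)
move=> _ [w _ <-].
have [->|w0] := eqVneq w 0.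
  left; apply/seteqP; split=> [t []//|t Et]; split=> //.
  by rewrite /halfspace/= big1// => i _; rewrite mxE mul0r.
right.
have [v Jv vw] : cover [set` J] (fun w => ball w (r w)) (`|w|^-1 *: w).
  by apply: SJ; rewrite /S/= normrZ normfV normr_id mulVf// normr_eq0.
exists v => //; exists (`|w|^-1 *: w); last first.
  by rewrite halfspaceZ// invr_gt0 normr_gt0.
move=> i /=; have := vw.2 ord0 i; rewrite /ball/= distrC => /ltW//.
Qed.

End Brackets.

(** * The strong law of large numbers for pairwise independent events *)

Lemma exists_isqrt n : exists k, (k ^ 2 <= n < k.+1 ^ 2)%N.
Proof.
elim: n => [|n [k /andP[kn nk]]]; first by exists 0%N.
have [h|h] := ltnP n.+1 (k.+1 ^ 2); [exists k|exists k.+1]; apply/andP; split => //.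
  exact: leqW.
by apply: leq_ltn_trans nk _; rewrite ltn_exp2r.
Qed.

(** Between [k ^ 2] and [(k + 1) ^ 2] a sum of terms bounded by [c] moves by at
    most [2 c k], which is negligible compared with [k ^ 2]. *)
Lemma cesaro_squares {R : realType} (x : nat -> R) (c : R) :
  (forall i, `|x i| <= c) ->
  (\sum_(i < k.+1 ^ 2) x i) / (k.+1 ^ 2)%:R @[k --> \oo] --> (0 : R) ->
  (\sum_(i < n) x i) / n%:R @[n --> \oo] --> (0 : R).
Proof.
move=> xc /cvgrPdist_le sq; apply/cvgrPdist_le => e e0.
have c0 : 0 <= c by apply: le_trans (xc 0%N).
have e20 : 0 < e / 2 by rewrite divr_gt0.
have c1 : 0 < 2 * c + 1 by rewrite ltr_wpDl// mulr_ge0.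
have [K1 _ HK1] := sq _ e20.
have [K2 _ HK2] := near_infty_natSinv_lt (PosNum (divr_gt0 e20 c1)).
exists ((maxn K1 K2).+2 ^ 2)%N => // n /= Kn.
have [k /andP[kn nk]] := exists_isqrt n.
have Kk : ((maxn K1 K2).+1 < k)%N.
  by have := leq_ltn_trans Kn nk; rewrite ltn_exp2r// ltnS.
case: k => [//|k] in kn nk Kk *.
have n0 : 0 < n%:R :> R by rewrite ltr0n; apply: leq_trans kn; rewrite expn_gt0.
have k0 : 0 < (k.+1 ^ 2)%:R :> R by rewrite ltr0n expn_gt0.
have step : `|\sum_(i < n) x i - \sum_(i < k.+1 ^ 2) x i| <= (2 * c) * k.+1%:R.
  rewrite -!(big_mkord xpredT) (big_cat_nat (n := (k.+1 ^ 2)%N))//=.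
  rewrite [X in X - _]addrC addrK.
  apply: le_trans (ler_norm_sum _ _ _) _.
  apply: le_trans (ler_sum _ (fun i _ => xc i)) _.
  rewrite sumr_const_nat -[leLHS]mulr_natr [2 * c]mulrC -mulrA ler_wpM2l// -natrM ler_nat.
  by move: nk; rewrite !expnS expn0 !muln1; lia.
rewrite sub0r normrN normrM normfV (ger0_norm (ltW n0)) ler_pdivrMr//.
have {HK1} h1 : `|\sum_(i < k.+1 ^ 2) x i| <= e / 2 * (k.+1 ^ 2)%:R.
  have /= := HK1 k; rewrite sub0r normrN normrM normfV (ger0_norm (ltW k0)).
  by rewrite ler_pdivrMr//; apply; lia.
have {HK2} h2 : (2 * c) * k.+1%:R <= e / 2 * (k.+1 ^ 2)%:R.
  have /= := HK2 k; rewrite -[k.+1%:R^-1]mul1r ltr_pdivrMr// mulrAC ltr_pdivlMr// mul1r.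
  move=> /(_ _)/ltW h; rewrite expnS expn1 natrM mulrA ler_wpM2r//.
  apply: le_trans (h _); first by rewrite lerDl.
  by lia.
have -> : \sum_(i < n) x i = \sum_(i < k.+1 ^ 2) x i +
  (\sum_(i < n) x i - \sum_(i < k.+1 ^ 2) x i) by rewrite addrC subrK.
apply: le_trans (ler_normD _ _) _; apply: le_trans (lerD h1 (le_trans step h2)) _.
by rewrite -mulrDl -splitr ler_wpM2l ?(ltW e0)// ler_nat.
Qed.

Lemma sum_inv_squares_le2 {R : realType} n : \sum_(0 <= k < n) (k.+1 ^ 2)%:R^-1 <= 2 :> R.
Proof.
case: n => [|n]; first by rewrite big_geq.
(* The sharper bound [2 - 1 / n] telescopes, as [1 / k ^ 2] is at most
   [1 / (k - 1) - 1 / k]. *)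
apply: (@le_trans _ _ (2 - n.+1%:R^-1)); last by rewrite gerBl.
elim: n => [|n IH]; first by rewrite big_nat1 !invr1; lra.
rewrite big_nat_recr//=; apply: le_trans (lerD IH (lexx _)) _.
rewrite -addrA lerD2l -subr_ge0.
have n0 : (0 : R) <= n%:R by [].
have -> : - n.+2%:R^-1 - (- n.+1%:R^-1 + (n.+2 ^ 2)%:R^-1) =
   (n.+2%:R ^+ 2 * n.+1%:R)^-1 :> R.
  by rewrite natrX -!natr1; field; rewrite !lt0r_neq0//; lra.
by rewrite invr_ge0 mulr_ge0// exprn_ge0.
Qed.

Section BoundedIntegrals.
Context {d : measure_display} {Omega : measurableType d} {R : realType}.
Variable Q : probability Omega R.

Lemma integrable_bounded (f : Omega -> R) (c : R) :
  measurable_fun setT f -> (forall w, `|f w| <= c) ->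
  Q.-integrable setT (EFin \o f).
Proof.
move=> mf fc; apply: measurable_bounded_integrable => //.
  by rewrite (le_lt_trans (probability_le1 _ _))// ltry.
exists c; split; first exact: num_real.
by move=> M cM w _ /=; apply: le_trans (fc w) (ltW cM).
Qed.

Lemma Rintegral_sum n (f : nat -> Omega -> R) :
  (forall i, Q.-integrable setT (EFin \o f i)) ->
  \int[Q]_w (\sum_(i < n) f i w) = \sum_(i < n) \int[Q]_w f i w.
Proof.
move=> fi; elim: n => [|n IH].
  by under eq_Rintegral do rewrite big_ord0; rewrite big_ord0 Rintegral_cst// mul0r.
under eq_Rintegral do rewrite big_ord_recr.
rewrite big_ord_recr RintegralD//= ?IH//.
rewrite (_ : _ \o _ = fun w => (\sum_(i < n) (EFin \o f i) w)%E).
  exact: integrable_sum.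
by apply/funext => w /=; rewrite sumEFin.
Qed.

Lemma Rintegral_indic (A : set Omega) : measurable A ->
  \int[Q]_w \1_A w = fine (Q A).
Proof. by move=> mA; rewrite /Rintegral integral_indic// setIT. Qed.

Lemma Rintegral_prob_cst (c : R) : \int[Q]_w c = c.
Proof.
rewrite Rintegral_cst// -[RHS]mulr1; congr (_ * _).
exact: (congr1 fine (probability_setT Q)).
Qed.

End BoundedIntegrals.

Section SLLN.
Context {d : measure_display} {Omega : measurableType d} {R : realType}.
Variable Q : probability Omega R.
Variables (B : nat -> set Omega) (p : R).
Hypothesis mB : forall i, measurable (B i).
Hypothesis QB : forall i, Q (B i) = p%:E.
Hypothesis QBB : forall i j, i != j -> Q (B i `&` B j) = (p * p)%:E.

Let X i w : R := \1_(B i) w - p.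

Let p01 : 0 <= p <= 1.
Proof. by rewrite -!lee_fin -(QB 0) measure_ge0 probability_le1. Qed.

Let X1 i w : `|X i w| <= 1.
Proof.
rewrite /X indicE; have /andP[p0 p1] := p01.
by case: (_ \in _) => /=; rewrite ler_norml; apply/andP; split; lra.
Qed.

Let mX i : measurable_fun setT (X i).
Proof. by apply: measurable_funB => //; exact: measurable_indic. Qed.

Let mS n : measurable_fun setT (fun w => \sum_(i < n) X i w).
Proof. by apply: measurable_sum. Qed.

(* By independence the integral is 0 for [i != j]. *)
Let EXX i j : \int[Q]_w (X i w * X j w) <= (i == j)%:R.
Proof.
have [->|ij] := eqVneq i j.
  rewrite -[leRHS](_ : \int[Q]_w 1 = 1); last first.
    exact: Rintegral_prob_cst.
  apply: le_Rintegral => //.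
  - apply: (integrable_bounded _ (c := 1)); first exact: measurable_funM.
    by move=> w; rewrite normrM mulr_ile1.
  - by apply: (integrable_bounded _ (c := 1)) => // w; rewrite normr1.
  - move=> w _; apply: le_trans (ler_norm _) _.
    by rewrite normrM mulr_ile1.
have iB (A : set Omega) : measurable A ->
    Q.-integrable setT (EFin \o (\1_A : Omega -> R)).
  move=> mA; apply: (integrable_bounded _ (c := 1)); first exact: measurable_indic.
  by move=> w; rewrite indicE; case: (_ \in _); rewrite ?normr1 ?normr0.
have iX k : Q.-integrable setT (EFin \o X k) by apply: (integrable_bounded _ (c := 1)).
have EX k : \int[Q]_w X k w = 0.
  rewrite RintegralB//; [|exact: iB|]; last first.
    by apply: (integrable_bounded _ (c := `|p|)).
  by rewrite Rintegral_indic// Rintegral_prob_cst QB /= subrr.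
have -> : \int[Q]_w (X i w * X j w) =
    \int[Q]_w (\1_(B i `&` B j) w - p * \1_(B i) w - p * X j w).
  apply: eq_Rintegral => w _; rewrite /X (@indicI _ R); rewrite /=; ring.
have mI := measurableI _ _ (mB i) (mB j).
have ipB : Q.-integrable setT (EFin \o (fun w => p * \1_(B i) w)).
  apply: (integrable_bounded _ (c := `|p|)).
    by apply: measurable_funM => //; exact: measurable_indic.
  by move=> w; rewrite indicE; case: (_ \in _); rewrite ?mulr1 ?mulr0 ?normr0.
have ipX : Q.-integrable setT (EFin \o (fun w => p * X j w)).
  apply: (integrable_bounded _ (c := `|p|)); first exact: measurable_funM.
  by move=> w; rewrite normrM ler_piMr.
have iD : Q.-integrable setT (EFin \o (fun w => \1_(B i `&` B j) w - p * \1_(B i) w)).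
  have := integrableB measurableT (iB _ mI) ipB; exact.
rewrite RintegralB// RintegralB//; last exact: iB.
rewrite RintegralZl//; last exact: iB.
rewrite RintegralZl// EX !Rintegral_indic// QB QBB//=.
by rewrite mulr0 subr0 subrr.
Qed.

Let ESS n : \int[Q]_w ((\sum_(i < n) X i w) ^+ 2) <= n%:R.
Proof.
have iXX i j : Q.-integrable setT (EFin \o (fun w => X i w * X j w)).
  apply: (integrable_bounded _ (c := 1)); first exact: measurable_funM.
  by move=> w; rewrite normrM mulr_ile1.
under eq_Rintegral do rewrite expr2 mulr_suml.
rewrite (Rintegral_sum _ (f := fun i w => X i w * \sum_(j < n) X j w)); last first.
  move=> i; apply: (integrable_bounded _ (c := n%:R)); first exact: measurable_funM.
  move=> w; rewrite normrM -[leRHS]mul1r ler_pM//.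
  apply: le_trans (ler_norm_sum _ _ _) _.
  apply: le_trans (ler_sum _ (fun (i : 'I_n) _ => X1 i w)) _.
  by rewrite sumr_const card_ord.
apply: (@le_trans _ _ (\sum_(i < n) (1 : R))); last by rewrite sumr_const card_ord.
apply: ler_sum => i _.
under eq_Rintegral do rewrite mulr_sumr.
rewrite (Rintegral_sum _ (f := fun j w => X i w * X j w))//.
apply: le_trans (ler_sum _ (fun (j : 'I_n) _ => EXX i j)) _.
rewrite (bigD1 i)//= eqxx big1 ?addr0// => j ji.
by move: ji; rewrite -val_eqE eq_sym => /negbTE /= ->.
Qed.

(** The averages of the centred indicators along [n = (k + 1) ^ 2] have second
    moments at most [1 / (k + 1) ^ 2]. These are summable, so that almost surely
    the squared averages form a convergent series, hence tend to 0 along the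
    squares; [cesaro_squares] does the rest. *)
Lemma slln_events :
  {ae Q, forall w : Omega,
    (\sum_(i < n) \1_(B i) w) / n%:R @[n --> \oo] --> p}.
Proof.
pose Y k w : R := ((\sum_(i < k.+1 ^ 2) X i w) / (k.+1 ^ 2)%:R) ^+ 2.
have Y0 k w : 0 <= Y k w by exact: sqr_ge0.
have mY k : measurable_fun setT (Y k).
  by apply: measurable_funX; apply: measurable_funM.
have iY k : Q.-integrable setT (EFin \o Y k).
  apply: (integrable_bounded _ (c := 1)) => // w; rewrite /Y normrX expr_le1//.
  rewrite normrM normfV (ger0_norm (ler0n _ _)) ler_pdivrMr ?ltr0n ?expn_gt0// mul1r.
  apply: le_trans (ler_norm_sum _ _ _) _.
  apply: le_trans (ler_sum _ (fun (i : 'I_(k.+1 ^ 2)) _ => X1 i w)) _.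
  by rewrite sumr_const card_ord.
have EY k : (\int[Q]_w (Y k w)%:E <= ((k.+1 ^ 2)%:R^-1)%:E)%E.
  rewrite -[leLHS]fineK; last exact: (integrable_fin_num measurableT (iY k)).
  rewrite lee_fin.
  have -> : fine (\int[Q]_w (Y k w)%:E)%E =
      (k.+1 ^ 2)%:R ^- 2 * \int[Q]_w ((\sum_(i < k.+1 ^ 2) X i w) ^+ 2).
    rewrite -RintegralZl//.
      by apply: eq_Rintegral => w _; rewrite /Y exprMn exprVn mulrC.
    apply: (integrable_bounded _ (c := (k.+1 ^ 2)%:R ^+ 2)).
      exact: measurable_funX.
    move=> w; rewrite normrX lerXn2r ?nnegrE//.
    apply: le_trans (ler_norm_sum _ _ _) _.
    apply: le_trans (ler_sum _ (fun (i : 'I_(k.+1 ^ 2)) _ => X1 i w)) _.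
    by rewrite sumr_const card_ord.
  apply: le_trans (ler_wpM2l _ (ESS _)) _; first by rewrite invr_ge0 exprn_ge0.
  by rewrite expr2 invfM -mulrA mulVf ?mulr1// pnatr_eq0 -lt0n expn_gt0.
have sumY : (\int[Q]_w (\sum_(0 <= k <oo) (Y k w)%:E) < +oo)%E.
  rewrite integral_nneseries//; last 2 first.
    by move=> k; apply/measurable_EFinP.
    by move=> k w _; rewrite lee_fin.
  apply: (@le_lt_trans _ _ 2%:E); last exact: ltry.
  apply: lime_le.
    by apply: is_cvg_nneseries => k _ _; apply: integral_ge0 => w _; rewrite lee_fin.
  apply: nearW => n; apply: le_trans (lee_sum _ (fun k _ => EY k)) _.
  by rewrite sumEFin lee_fin sum_inv_squares_le2.
have iSum : Q.-integrable setT (fun w => \sum_(0 <= k <oo) (Y k w)%:E)%E.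
  apply/integrableP; split.
    apply: ge0_emeasurable_sum => [k w _ _|k _]; first by rewrite lee_fin.
    exact/measurable_EFinP.
  under eq_integral => w _.
    rewrite gee0_abs; first over.
    by apply: nneseries_ge0 => k _ _; rewrite lee_fin.
  exact: sumY.
have := integrable_ae measurableT iSum.
apply: filterS => w /(_ I) fin.
have {fin} tail : (\sum_(N <= k <oo) (Y k w)%:E)%E @[N --> \oo] --> 0%E.
  apply: nneseries_tail_cvg => [|k _]; last by rewrite lee_fin.
  by rewrite ltey_eq fin.
have Yw : Y k w @[k --> \oo] --> (0 : R).
  apply/cvgrPdist_le => e e0.
  have /fine_cvgP[[N1 _ h1] /cvgrPdist_le/(_ _ e0)[N2 _ h2]] := tail.
  exists (maxn N1 N2) => // n /=; rewrite geq_max => /andP[n1 n2].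
  have {h1} h1 := h1 _ n1; have {h2} /= := h2 _ n2.
  rewrite !sub0r !normrN; apply: le_trans.
  rewrite (ger0_norm (Y0 _ _)) ger0_norm; last first.
    by apply/fine_ge0/nneseries_ge0 => k _ _; rewrite lee_fin.
  rewrite -lee_fin fineK//.
  have := @nneseries_lim_ge R (fun k => (Y k w)%:E) xpredT n n.+1.
  by rewrite big_nat1; apply => k _ _; rewrite lee_fin.
have sq : (\sum_(i < k.+1 ^ 2) X i w) / (k.+1 ^ 2)%:R @[k --> \oo] --> (0 : R).
  apply/cvgrPdist_le => e e0; move/cvgrPdist_le: Yw => /(_ (e ^+ 2)).
  rewrite exprn_gt0// => /(_ isT)[N _ h]; exists N => // n /h /=.
  by rewrite !sub0r !normrN /Y normrX ler_pXn2r ?nnegrE ?(ltW e0)//.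
have /cvgrPdist_le h := cesaro_squares (fun i => X1 i w) sq.
apply/cvgrPdist_le => e e0; have [N _ hN] := h _ e0.
exists N.+1 => // n /= Nn; have /= := hN n (ltnW Nn).
rewrite sub0r normrN sumrB sumr_const card_ord distrC mulrBl -[p *+ n]mulr_natr.
by rewrite mulfK// pnatr_eq0 -lt0n (leq_trans _ Nn).
Qed.

End SLLN.

(** * The Glivenko-Cantelli theorem for bracketed classes *)

Lemma slln_indicator {d d'} {Omega : measurableType d} {T : measurableType d'}
    {R : realType} (Q : probability Omega R) (P : probability T R)
    (X : nat -> {RV Q >-> T}) (A : set T) :
  mutually_independent X -> (forall i, has_law (X i) P) -> measurable A ->
  {ae Q, forall w : Omega,
    (\sum_(i < n) \1_A (X i w)) / n%:R @[n --> \oo] --> fine (P A)}.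
Proof.
move=> ind law mA.
have mXA i : measurable (X i @^-1` A).
  by rewrite -[X in measurable X]setTI; exact: measurable_funP.
have PA : P A = (fine (P A))%:E by rewrite fineK// fin_num_measure.
have QA i : Q (X i @^-1` A) = (fine (P A))%:E.
  by rewrite -PA; exact: law.
apply: (slln_events mXA QA) => i j ij.
have := ind [fset i; j]%fset (fun=> A) (fun _ _ => mA).
rewrite big_fsetU1/= ?inE// big_seq_fset1 !QA -EFinM => <-.
congr (Q _); apply/seteqP; split=> [w [Ai Aj] k /=|w h].
  by rewrite !inE => /orP[] /eqP ->.
by split; apply: h; rewrite /= !inE eqxx ?orbT.
Qed.

(** If [L `<=` A `<=` U], both the empirical and the true mass of [A] are
    between those of [L] and [U]; the true masses differ by at most the gap, and
    the empirical ones are close to the true ones, for finitely many [L] and [U]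
    at once. Brackets are fixed for the gaps [1 / (k + 1)], so that one
    negligible set serves all [e]. *)
Lemma glivenko_cantelli {d d'} {Omega : measurableType d} {T : measurableType d'}
    {R : realType} (Q : probability Omega R) (P : probability T R)
    (X : nat -> {RV Q >-> T}) (C : set (set T)) :
  mutually_independent X -> (forall i, has_law (X i) P) ->
  (forall A, C A -> measurable A) ->
  (forall e, 0 < e -> finitely_bracketed P e C) ->
  {ae Q, forall w : Omega, forall e : R, 0 < e -> \forall n \near \oo,
    forall A, C A ->
      `|(\sum_(i < n) \1_A (X i w)) / n%:R - fine (P A)| <= e}.
Proof.
move=> ind law mC bC.
have bk k : exists s : seq (set T * set T),
    (forall b, b \in s ->
      [/\ measurable b.1, measurable b.2 & (P (b.2 `\` b.1) <= (k.+1%:R^-1)%:E)%E]) /\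
    (forall A, C A -> exists2 b, b \in s & b.1 `<=` A /\ A `<=` b.2).
  have [|F /finite_seqP[s ->] sP] := bC k.+1%:R^-1; first by rewrite invr_gt0.
  by exists s.
have {bk} /choice[s sP] := bk.
pose b k m := nth (set0, set0) (s k) m.
have mb k m : measurable (b k m).1 /\ measurable (b k m).2.
  have [ms|ms] := ltnP m (size (s k)); last first.
    by rewrite /b nth_default//=; split; exact: measurable0.
  by have [h _] := sP k; have [] := h _ (mem_nth (set0, set0) ms).
have cvgL k m := slln_indicator ind law (mb k m).1.
have cvgU k m := slln_indicator ind law (mb k m).2.
have cvgLU : {ae Q, forall w, forall k m,
    ((\sum_(i < n) \1_((b k m).1) (X i w)) / n%:R @[n --> \oo] --> fine (P (b k m).1)) /\
    ((\sum_(i < n) \1_((b k m).2) (X i w)) / n%:R @[n --> \oo] --> fine (P (b k m).2))}.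
  apply: ae_foralln => k; apply: ae_foralln => m.
  by apply: filterS2 (cvgL k m) (cvgU k m) => w ? ?; split.
apply: filterS cvgLU => w cvgw e e0.
have e20 : 0 < e / 2 by rewrite divr_gt0.
have [k _ /(_ k (leqnn k)) /= ke] := near_infty_natSinv_lt (PosNum e20).
have near_b : \forall n \near \oo, forall m, (m < size (s k))%N ->
    `|(\sum_(i < n) \1_((b k m).1) (X i w)) / n%:R - fine (P (b k m).1)| <= e / 2 /\
    `|(\sum_(i < n) \1_((b k m).2) (X i w)) / n%:R - fine (P (b k m).2)| <= e / 2.
  have : \forall n \near \oo, forall m : 'I_(size (s k)),
    `|(\sum_(i < n) \1_((b k m).1) (X i w)) / n%:R - fine (P (b k m).1)| <= e / 2 /\
    `|(\sum_(i < n) \1_((b k m).2) (X i w)) / n%:R - fine (P (b k m).2)| <= e / 2.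
    apply: filter_forall => m; have [/cvgrPdist_le h1 /cvgrPdist_le h2] := cvgw k m.
    apply: filterS2 (h1 _ e20) (h2 _ e20) => n.
    by rewrite distrC [X in _ -> X <= _ -> _]distrC.
  by apply: filterS => n h m ms; exact: (h (Ordinal ms)).
apply: filterS near_b => n near_b A CA.
have [sm sC] := sP k; have [bA bs [LA AU]] := sC A CA.
have ms : (index bA (s k) < size (s k))%N by rewrite index_mem.
have := near_b _ ms; rewrite /b nth_index//.
have [mL mU gap] := sm _ bs.
set L := bA.1 in LA mL gap *; set U := bA.2 in AU mU gap *.
move=> [hL hU].
have mA := mC _ CA.
have emp (A1 A2 : set T) : A1 `<=` A2 ->
    (\sum_(i < n) \1_A1 (X i w)) / n%:R <= (\sum_(i < n) \1_A2 (X i w)) / n%:R :> R.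
  move=> A12; rewrite ler_wpM2r// ?invr_ge0//; apply: ler_sum => i _.
  rewrite !indicE ler_nat.
  by case: (boolP (_ \in A1)) => // /set_mem/A12/mem_set ->.
have PE (B : set T) : measurable B -> (fine (P B))%:E = P B.
  by move=> mB; rewrite fineK// fin_num_measure.
have PU : fine (P U) - fine (P L) <= e / 2.
  apply: le_trans (ltW ke).
  rewrite lerBlDl -lee_fin EFinD !PE//.
  apply: le_trans (leeD2l _ gap).
  apply: le_trans (measureU2 _ mL (measurableD mU mL)).
  apply: le_measure; rewrite ?inE//.
    by apply: measurableU => //; exact: measurableD.
  by move=> t Ut; have [|] := pselect (L t); [left|right].
have PLA : fine (P L) <= fine (P A).
  by rewrite -lee_fin !PE// le_measure ?inE.
have PAU : fine (P A) <= fine (P U).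
  by rewrite -lee_fin !PE// le_measure ?inE.
move: hL hU (emp _ _ LA) (emp _ _ AU) PU PLA PAU; rewrite !ler_norml.
move=> /andP[? ?] /andP[? ?] ? ? ? ? ?; apply/andP; split; lra.
Qed.

(** * From pairs of observations to one sample *)

(** With [F] the sum over all pairs and [D] the diagonal, the sum over [i < j] is
    [(F - D) / 2]. The difference of the averages is then
    [(F / n ^ 2 - D / n) / (n - 1)], where both quotients lie in [[0, 1]]. *)
Lemma pairs_near_square {R : realType} (h : nat -> nat -> R) n :
  (forall i j, h i j = h j i) -> (forall i j, 0 <= h i j <= 1) -> (1 < n)%N ->
  `|('C(n, 2))%:R^-1 * \sum_(i < n) \sum_(j < n | (i < j)%N) h i j -
    (\sum_(i < n) \sum_(j < n) h i j) / n%:R ^+ 2| <= (n.-1)%:R^-1.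
Proof.
move=> hC h01 n1.
set U := \sum_(i < n) \sum_(j < n | (i < j)%N) h i j.
set F := \sum_(i < n) \sum_(j < n) h i j.
pose D := \sum_(i < n) h i i.
have FE : F = 2 * U + D.
  have -> : F = U + (\sum_(i < n) \sum_(j < n | (j < i)%N) h i j + D).
    rewrite /F /U /D -!big_split/=; apply: eq_bigr => i _.
    rewrite (bigID (fun j : 'I_n => (i < j)%N))/=; congr (_ + _).
    rewrite (bigD1 i) ?ltnn//= addrC; congr (_ + _).
    by apply: eq_bigl => j; rewrite -leqNgt -val_eqE/= [RHS]ltn_neqAle andbC.
  rewrite [X in _ + (X + _)](_ : _ = U); first by ring.
  rewrite /U (exchange_big_dep xpredT)//=; apply: eq_bigr => i _.
  by apply: eq_bigr => j _; exact: hC.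
have D0 : 0 <= D <= n%:R.
  rewrite sumr_ge0 => [/=|i _]; last by have /andP[] := h01 i i.
  rewrite -[n in leRHS]card_ord -sumr_const; apply: ler_sum => i _.
  by have /andP[] := h01 i i.
have F0 : 0 <= F <= n%:R ^+ 2.
  rewrite sumr_ge0 => [/=|i _]; last by apply: sumr_ge0 => j _; have /andP[] := h01 i j.
  rewrite expr2 mulr_natr -[n in _ *+ n]card_ord -sumr_const; apply: ler_sum => i _.
  rewrite -[n in leRHS]card_ord -sumr_const; apply: ler_sum => j _.
  by have /andP[] := h01 i j.
have [m nE] : exists m, n = m.+2.
  by case: n n1 {U F D FE D0 F0} => [//|[//|m]] _; exists m.
have CE : ('C(n, 2))%:R = n%:R * (n.-1)%:R / 2 :> R.
  have /(congr1 (fun k => k%:R : R)) := bin_ffact n 2.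
  rewrite ffactnS ffactn1 !natrM => <-; rewrite mulfK//.
rewrite CE.
have m0 : 0 < (n.-1)%:R :> R by rewrite nE.
have n0 : n%:R = (n.-1)%:R + 1 :> R by rewrite natr1 nE.
have -> : U = (F - D) / 2 by rewrite FE; field.
set k := (n.-1)%:R in m0 n0 *.
rewrite n0 in D0 F0 *.
have -> : ((k + 1) * k / 2)^-1 * ((F - D) / 2) - F / (k + 1) ^+ 2 =
   (F / (k + 1) ^+ 2 - D / (k + 1)) / k.
  by field; rewrite !lt0r_neq0//; lra.
have k1 : 0 < k + 1 by lra.
rewrite normrM normfV (ger0_norm (ltW m0)) ler_piMl ?invr_ge0 ?(ltW m0)//.
have a01 : 0 <= F / (k + 1) ^+ 2 <= 1.
  by rewrite divr_ge0 ?(ltW (exprn_gt0 _ _))//=;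
    [rewrite ler_pdivrMr ?exprn_gt0// mul1r|]; case/andP: F0.
have b01 : 0 <= D / (k + 1) <= 1.
  by rewrite divr_ge0 ?(ltW k1)//=; [rewrite ler_pdivrMr// mul1r|]; case/andP: D0.
rewrite ler_norml; move: a01 b01 => /andP[? ?] /andP[? ?]; apply/andP; split; lra.
Qed.

(** The two masses are compared through the mixed one, the average over the
    sample of the [P]-masses of the sections. Replacing [P_n] by [P] in the
    second factor is the hypothesis averaged over the sample. By symmetry of [Z]
    the mixed mass is also the [P]-integral of the empirical masses of the
    sections, and replacing [P_n] by [P] in the first factor is the hypothesis
    integrated against [P]. *)
Lemma empirical_product_near {d} {T : measurableType d} {R : realType}
    (P : probability T R) (Z : set (T * T)) (xs : nat -> T) n (e : R) :
  measurable Z -> (forall u v, Z (u, v) -> Z (v, u)) -> (0 < n)%N ->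
  (forall u, `|(\sum_(i < n) \1_(xsection Z u) (xs i)) / n%:R -
               fine (P (xsection Z u))| <= e) ->
  `|(\sum_(i < n) \sum_(j < n) \1_Z (xs i, xs j)) / n%:R ^+ 2 -
    \int[(P \x P)%E]_z \1_Z z| <= e + e.
Proof.
move=> mZ Zsym n0 close.
pose emp u : R := (\sum_(i < n) \1_(xsection Z u) (xs i)) / n%:R.
pose pr u : R := fine (P (xsection Z u)).
have nR : 0 < n%:R :> R by rewrite ltr0n.
have msec u : measurable (xsection Z u) by exact: measurable_xsection.
have indicC u v : \1_(xsection Z u) v = \1_(xsection Z v) u :> R.
  by rewrite !indicE !mem_xsection; congr ((nat_of_bool _)%:R); apply/idP/idP;
    rewrite !inE; exact: Zsym.
have indicZ u v : \1_Z (u, v) = \1_(xsection Z u) v :> R.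
  by rewrite !indicE mem_xsection.
have prE u : (P (xsection Z u) = (pr u)%:E)%E by rewrite fineK// fin_num_measure.
have pr01 u : `|pr u| <= 1.
  by rewrite ger0_norm ?fine_ge0// -lee_fin -prE probability_le1.
have ipr : P.-integrable setT (EFin \o pr).
  apply: (integrable_bounded _ (c := 1)) => //.
  by apply: measurableT_comp => //; exact: measurable_fun_xsection.
have iind u : P.-integrable setT (EFin \o (\1_(xsection Z u) : T -> R)).
  apply: (integrable_bounded _ (c := 1)); first exact: measurable_indic.
  by move=> v; rewrite indicE; case: (_ \in _); rewrite ?normr1 ?normr0.
have iemp : P.-integrable setT (EFin \o emp).
  apply: (integrable_bounded _ (c := 1)).
    apply: measurable_funM => //; apply: measurable_sum => i.
    rewrite (_ : (fun x => _) = \1_(xsection Z (xs i))); last first.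
      by apply/funext => u; exact: indicC.
    exact: measurable_indic.
  move=> u; rewrite normrM normfV (ger0_norm (ltW nR)) ler_pdivrMr// mul1r.
  apply: le_trans (ler_norm_sum _ _ _) _.
  rewrite -[n in leRHS]card_ord -sumr_const; apply: ler_sum => i _.
  by rewrite indicE; case: (_ \in _); rewrite ?normr1 ?normr0.
have prodE : \int[(P \x P)%E]_z \1_Z z = \int[P]_u pr u.
  rewrite /Rintegral integral_indic// setIT; congr fine.
  by apply: eq_integral => u _ /=; rewrite prE.
have swap : \int[P]_u emp u = (\sum_(i < n) pr (xs i)) / n%:R.
  rewrite RintegralZr//.
    rewrite (Rintegral_sum _ (f := fun i u => \1_(xsection Z u) (xs i))).
      congr (_ / _); apply: eq_bigr => i _.
      rewrite /pr -(Rintegral_indic P (msec (xs i))); apply: eq_Rintegral => u _.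
      exact: indicC.
    move=> i; rewrite (_ : (fun u => _) = \1_(xsection Z (xs i))) //.
    by apply/funext => u; exact: indicC.
  have -> : (EFin \o fun u => \sum_(i < n) \1_(xsection Z u) (xs i)) =
     fun u => (\sum_(i < n) (EFin \o (\1_(xsection Z (xs i)) : T -> R)) u)%E.
    apply/funext => u /=; rewrite sumEFin; congr EFin.
    by apply: eq_bigr => i _; exact: indicC.
  by apply: integrable_sum.
have rowE : (\sum_(i < n) \sum_(j < n) \1_Z (xs i, xs j)) / n%:R ^+ 2 =
    (\sum_(i < n) emp (xs i)) / n%:R :> R.
  rewrite expr2 invfM mulrA; congr (_ / _); rewrite mulr_suml.
  apply: eq_bigr => i _; congr (_ / _); apply: eq_bigr => j _; exact: indicZ.
rewrite rowE prodE -[X in `|X|](subrKA (\int[P]_u emp u)).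
apply: le_trans (ler_normD _ _) (lerD _ _).
  rewrite swap -mulrBl -sumrB normrM normfV (ger0_norm (ltW nR)) ler_pdivrMr//.
  apply: le_trans (ler_norm_sum _ _ _) _.
  rewrite mulr_natr -[n in leRHS]card_ord -sumr_const; apply: ler_sum => i _.
  exact: close.
rewrite -RintegralB//.
have iB : P.-integrable setT (EFin \o (fun u => emp u - pr u)).
  have := integrableB measurableT iemp ipr; exact.
apply: le_trans (le_normr_Rintegral _ iB) _ => //.
rewrite -[leRHS](Rintegral_prob_cst P).
have e0 : 0 <= e by apply: le_trans (close (xs 0%N)).
apply: le_Rintegral => //.
- by apply/integrable_norm.
- by apply: (integrable_bounded _ (c := e)) => // u; rewrite ger0_norm.
- move=> u _; exact: close.
Qed.
(** * Lenses as intersections of quadratic half-spaces *)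

Definition sqdist {R : realType} {p : nat} (u v : 'rV[R]_p) : R :=
  \sum_(j < p) (u ord0 j - v ord0 j) ^+ 2.

Lemma enorm_sqdist {R : realType} {p : nat} (u v : 'rV[R]_p) :
  enorm (u - v) = Num.sqrt (sqdist u v).
Proof. by rewrite /enorm; congr Num.sqrt; apply: eq_bigr => j _; rewrite !mxE. Qed.

Lemma sqdist_ge0 {R : realType} {p : nat} (u v : 'rV[R]_p) : 0 <= sqdist u v.
Proof. by apply: sumr_ge0 => j _; exact: sqr_ge0. Qed.

Lemma sqdistC {R : realType} {p : nat} (u v : 'rV[R]_p) : sqdist u v = sqdist v u.
Proof. by apply: eq_bigr => j _; rewrite -sqrrN opprB. Qed.

(** The condition on [tau] becomes [|u - v|^2 <= tau ^ 2] when [tau] is finite,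
    and [0 <= 0] when it is infinite; [b] and [t] treat the two cases alike. *)
Lemma lens_sqdist {R : realType} {p : nat} (tau : \bar R) : (0 <= tau)%E ->
  exists b t : R, forall (x u v : 'rV[R]_p), lens tau x (u, v) <->
    [/\ sqdist x u <= sqdist u v, sqdist x v <= sqdist u v & b * sqdist u v <= t].
Proof.
move=> tau0.
have [b [t bt]] : exists b t : R, forall s, 0 <= s ->
    ((Num.sqrt s)%:E <= tau)%E = (b * s <= t).
  case: tau tau0 => [t t0|_|//]; last by exists 0, 0 => s _; rewrite leey mul0r lexx.
  exists 1, (t ^+ 2) => s s0; rewrite lee_fin in t0.
  by rewrite lee_fin mul1r -{1}(ger0_norm t0) -sqrtr_sqr ler_sqrt// sqr_ge0.
exists b, t => x u v; rewrite /lens /= !enorm_sqdist ge_max bt ?sqdist_ge0//.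
rewrite !ler_sqrt ?sqdist_ge0//.
by split=> [[/andP[]]|[-> ->]].
Qed.

Lemma lens_sym {R : realType} {p : nat} (tau : \bar R) (x u v : 'rV[R]_p) :
  lens tau x (u, v) -> lens tau x (v, u).
Proof.
by rewrite /lens/= maxC [enorm (v - u)]enorm_sqdist sqdistC -enorm_sqdist.
Qed.

Definition cons_fun {A : Type} {n : nat} (a : A) (f : 'I_n -> A) (i : 'I_n.+1) : A :=
  if unlift ord0 i is Some j then f j else a.

Lemma sum_cons_fun {R : realType} n (a b : R) (f g : 'I_n -> R) :
  \sum_(i < n.+1) cons_fun a f i * cons_fun b g i = a * b + \sum_(i < n) f i * g i.
Proof.
rewrite big_ord_recl /cons_fun unlift_none; congr (_ + _).
by apply: eq_bigr => i _; rewrite liftK.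
Qed.

(** The functions [1], [|y|^2] and the coordinates of [y], whose combinations
    include the equations of all spheres and hyperplanes. *)
Definition quadric_features {R : realType} {p : nat} (i : 'I_p.+2) (y : 'rV[R]_p) : R :=
  cons_fun 1 (cons_fun (\sum_(j < p) y ord0 j ^+ 2) (fun j => y ord0 j)) i.

Lemma quadric_halfspace {R : realType} {p : nat} (a b : R) (c : 'I_p -> R) :
  [set y : 'rV[R]_p |
     a + b * (\sum_(j < p) y ord0 j ^+ 2) + \sum_(j < p) c j * y ord0 j <= 0] =
  halfspace quadric_features (\row_i cons_fun a (cons_fun b c) i).
Proof.
rewrite /halfspace; apply: eq_set => y; congr (is_true (_ <= 0)).
under [RHS]eq_bigr do rewrite mxE.
by rewrite /quadric_features !sum_cons_fun mulr1 addrA.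
Qed.

Lemma sqdistE {R : realType} {p : nat} (u y : 'rV[R]_p) :
  sqdist u y = \sum_(j < p) u ord0 j ^+ 2 + \sum_(j < p) y ord0 j ^+ 2
     - \sum_(j < p) 2 * u ord0 j * y ord0 j.
Proof.
rewrite /sqdist -big_split -sumrB/=; apply: eq_bigr => j _; ring.
Qed.

Definition halfspaces3 {T : Type} {R : realType} {D : nat}
    (phi : 'I_D -> T -> R) : set (set T) :=
  [set A | exists w1 w2 w3,
    A = halfspace phi w1 `&` (halfspace phi w2 `&` halfspace phi w3)].

(** The three conditions on [v] put it outside an open ball around [u], in a
    half-space (the quadratic terms cancel), and, when [tau] is finite, in a
    closed ball around [u]. *)
Lemma xsection_lens {R : realType} {p : nat} (tau : \bar R) (x u : 'rV[R]_p) :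
  (0 <= tau)%E ->
  halfspaces3 quadric_features (xsection (lens tau x) u).
Proof.
move=> /(@lens_sqdist R p)[b [t lensE]].
pose n2 (y : 'rV[R]_p) := \sum_(j < p) y ord0 j ^+ 2.
exists (\row_i cons_fun (sqdist x u - n2 u)
         (cons_fun (-1) (fun j => 2 * u ord0 j)) i),
  (\row_i cons_fun (n2 x - n2 u)
         (cons_fun 0 (fun j => 2 * u ord0 j - 2 * x ord0 j)) i),
  (\row_i cons_fun (b * n2 u - t)
         (cons_fun b (fun j => - (b * (2 * u ord0 j)))) i).
rewrite -!quadric_halfspace; apply/seteqP.
have e2 (y : 'rV[R]_p) : \sum_(j < p) (2 * u ord0 j - 2 * x ord0 j) * y ord0 j =
  \sum_(j < p) 2 * u ord0 j * y ord0 j - \sum_(j < p) 2 * x ord0 j * y ord0 j.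
  by rewrite -sumrB; apply: eq_bigr => j _; rewrite mulrBl.
have e3 (y : 'rV[R]_p) : \sum_(j < p) - (b * (2 * u ord0 j)) * y ord0 j =
  - (b * \sum_(j < p) 2 * u ord0 j * y ord0 j).
  by rewrite mulr_sumr -sumrN; apply: eq_bigr => j _; ring.
split=> y; rewrite /xsection /= inE lensE e2 e3 (sqdistE u y) (sqdistE x y) /n2.
  by move=> [h1 h2 h3]; split; [|split]; lra.
by move=> [h1 [h2 h3]]; split; lra.
Qed.

Section Borel.
Context {R : realType} {p : nat}.

Lemma measurable_coord (j : 'I_p) :
  measurable_fun setT (fun y : borel_rV R p => y ord0 j).
Proof.
apply: (measurability _ (RGenOInfty.measurableE R)) => _ [_ [a ->] <-].
rewrite setTI; apply: sub_sigma_algebra.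
apply: (@open_comp 'rV[R]_p R (fun y => y ord0 j)); last exact: interval_open.
by move=> y _; exact: coord_continuous.
Qed.

Lemma measurable_quadric_features (i : 'I_p.+2) :
  measurable_fun setT (quadric_features i : borel_rV R p -> R).
Proof.
rewrite /quadric_features /cons_fun; case: (unlift _ _) => [k|] //.
case: (unlift _ _) => [j|]; first exact: measurable_coord.
by apply: measurable_sum => j; apply: measurable_funX; exact: measurable_coord.
Qed.

Lemma measurable_sqdist {d} {T : measurableType d} (f g : T -> borel_rV R p) :
  measurable_fun setT f -> measurable_fun setT g ->
  measurable_fun setT (fun z => sqdist (f z : 'rV[R]_p) (g z)).
Proof.
move=> mf mg; apply: measurable_sum => j; apply: measurable_funX.
by apply: measurable_funB; apply: (measurableT_comp (measurable_coord j)).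
Qed.

Lemma measurable_lens (tau : \bar R) (x : 'rV[R]_p) : (0 <= tau)%E ->
  measurable (lens tau x : set (borel_rV R p * borel_rV R p)).
Proof.
move=> /(@lens_sqdist R p)[b [t lensE]].
have -> : lens tau x =
    [set z | sqdist x z.1 <= sqdist z.1 z.2] `&`
    ([set z | sqdist x z.2 <= sqdist z.1 z.2] `&`
     [set z | b * sqdist z.1 z.2 <= t]).
  apply/seteqP; split=> -[u v] /=; first by move=> /lensE[? ? ?].
  by move=> [? [? ?]]; apply/lensE.
have m12 : measurable_fun setT
  (fun z : borel_rV R p * borel_rV R p => sqdist (z.1 : 'rV[R]_p) z.2).
  exact: measurable_sqdist measurable_fst measurable_snd.
apply: measurableI; last apply: measurableI.
- apply: measurable_le => //; apply: measurable_sqdist => //.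
- apply: measurable_le => //; apply: measurable_sqdist => //.
- by apply: measurable_le => //; apply: measurable_funM.
Qed.

End Borel.

Lemma measurable_halfspace {d} {T : measurableType d} {R : realType} {D : nat}
    (phi : 'I_D -> T -> R) (w : 'rV[R]_D) :
  (forall i, measurable_fun setT (phi i)) -> measurable (halfspace phi w).
Proof.
move=> mphi; apply: measurable_le => //.
by apply: measurable_sum => i; exact: measurable_funM.
Qed.

Lemma finitely_bracketed_halfspaces3 {d} {T : measurableType d} {R : realType}
    (P : probability T R) {D : nat} (phi : 'I_D -> T -> R) (e : R) :
  (forall i, measurable_fun setT (phi i)) -> 0 < e ->
  finitely_bracketed P e (halfspaces3 phi).
Proof.
move=> mphi e0; have e3 : 0 < e / 3 by rewrite divr_gt0.
have bh := finitely_bracketed_halfspace P mphi measurableT e3.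
have -> : e = e / 3 + (e / 3 + e / 3) by field.
apply: finitely_bracketed_sub (finitely_bracketedI bh (finitely_bracketedI bh bh)).
move=> _ [w1 [w2 [w3 ->]]].
exists (halfspace phi w1); first by exists w1 => //; rewrite setTI.
exists (halfspace phi w2 `&` halfspace phi w3) => //.
exists (halfspace phi w2); first by exists w2 => //; rewrite setTI.
by exists (halfspace phi w3) => //; exists w3 => //; rewrite setTI.
Qed.

Theorem theorem2p3 (R : realType) (p : nat) (hp : (1 <= p)%N)
    (P : probability (borel_rV R p) R)
    (d : measure_display) (Omega : measurableType d) (Q : probability Omega R)
    (X : nat -> {RV Q >-> borel_rV R p})
    (X_indep : mutually_independent X)
    (X_law : forall i : nat, has_law (X i) P) :
  {ae Q, forall w : Omega,
    (fun n : nat =>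
       ereal_sup [set (`| LLDn (fun i => X i w) n xt.1 xt.2
                          - LLD P xt.1 xt.2 |)%:E
                 | xt in [set xt : 'rV[R]_p * \bar R | (0 <= xt.2)%E]])
      @ \oo --> (0 : \bar R)}.
Proof.
pose C := halfspaces3 (fun i => quadric_features i : borel_rV R p -> R).
have mC A : C A -> measurable A.
  move=> [w1 [w2 [w3 ->]]].
  by do 2?apply: measurableI; apply: measurable_halfspace => i;
    exact: measurable_quadric_features.
have bC e : 0 < e -> finitely_bracketed P e C.
  by apply: finitely_bracketed_halfspaces3 => i; exact: measurable_quadric_features.
apply: filterS (glivenko_cantelli X_indep X_law mC bC) => w GC.
pose dn n (xt : 'rV[R]_p * \bar R) : R :=
  `|LLDn (fun i => X i w) n xt.1 xt.2 - LLD P xt.1 xt.2|.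
have sup_le n e : (forall x (tau : \bar R), (0 <= tau)%E -> dn n (x, tau) <= e) ->
    (0 <= ereal_sup [set (dn n xt)%:E | xt in [set xt | (0 <= xt.2)%E]] <= e%:E)%E.
  move=> dn_le; apply/andP; split.
    apply: (@le_trans _ _ (dn n (0, 0%E))%:E); first by rewrite lee_fin /dn.
    by apply: ereal_sup_ubound; exists (0, 0%E) => /=.
  by apply: ge_ereal_sup => _ [[x tau] /= tau0 <-]; rewrite lee_fin; exact: dn_le.
suff dev e : 0 < e -> \forall n \near \oo, forall x (tau : \bar R), (0 <= tau)%E ->
    `|LLDn (fun i => X i w) n x tau - LLD P x tau| <= e.
  apply/fine_cvgP; split.
    have [N _ HN] := dev 1 ltr01; exists N => // n Nn.
    have /andP[s0 s1] := sup_le n 1 (HN n Nn).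
    by rewrite ge0_fin_numE// (le_lt_trans s1)// ltry.
  apply/cvgrPdist_le => e e0.
  have [N _ HN] := dev e e0; exists N => // n Nn.
  have /andP[s0 s1] := sup_le n e (HN n Nn).
  rewrite sub0r normrN /= ger0_norm ?fine_ge0//.
  by rewrite -lee_fin fineK// ge0_fin_numE// (le_lt_trans s1)// ltry.
move=> e0; have e3 : 0 < e / 3 by rewrite divr_gt0.
have [N1 _ HN1] := GC _ e3.
have [N2 _ HN2] := near_infty_natSinv_lt (PosNum e3).
exists (maxn N1 N2).+2 => // n /= Nn x tau tau0.
have n1 : (1 < n)%N by lia.
have close u : `|(\sum_(i < n) \1_(xsection (lens tau x) u) (X i w)) / n%:R -
               fine (P (xsection (lens tau x) u))| <= e / 3.
  by apply: HN1; [rewrite /=; lia|exact: xsection_lens].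
have h1 := @empirical_product_near _ (borel_rV R p) R P (lens tau x)
  (fun i => X i w) n (e / 3) (measurable_lens x tau0)
  (fun u v => @lens_sym _ _ tau x u v) (ltnW n1) close.
have h2 := @pairs_near_square R (fun i j => \1_(lens tau x) (X i w, X j w)) n _ _ n1.
have {h2} /h2 h2 : forall i j, \1_(lens tau x) (X i w, X j w) =
    \1_(lens tau x) (X j w, X i w) :> R.
  move=> i j; rewrite !indicE; congr ((nat_of_bool _)%:R); apply/idP/idP;
  rewrite !inE; exact: lens_sym.
have {h2} /h2 h2 : forall i j, 0 <= (\1_(lens tau x) (X i w, X j w) : R) <= 1.
  by move=> i j; rewrite indicE; case: (_ \in _); rewrite ler01 lexx.
have h3 : (n.-1)%:R^-1 <= e / 3 :> R.
  apply: ltW; have /= := HN2 n.-2; rewrite (_ : n.-2.+1 = n.-1); last by lia.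
  by apply; lia.
have -> : e = e / 3 + (e / 3 + e / 3) by field.
pose F := \sum_(i < n) \sum_(j < n) (\1_(lens tau x) (X i w, X j w) : R).
rewrite /LLDn /LLD -(subrKA (F / n%:R ^+ 2)).
exact: le_trans (ler_normD _ _) (lerD (le_trans h2 h3) h1).
Qed.
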